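(* Let $A,B\in\mathbb Z$ and $\Delta=A^2-4B$. Let $p$ be an odd prime with $\left(\frac{\Delta}p\right)=1$, and suppose $\delta\in\mathbb Z$ satisfies $\delta^2\equiv\Delta\not\equiv0\pmod p$. Let $a,h$ be positive integers and $m\in\mathbb Z$ with $m\not\equiv0\pmod p$. If $\left(\frac B{p^a}\right)=1$, then $$\sum_{k=0}^{p^a-1}\frac{u_k(A,B)}{m^k}\cdot\frac{\binom{2k}k^h}{(-4)^{hk}}\equiv-\left(\frac{2m(A+\delta)}{p^a}\right)\sum_{k=0}^{p^a-1}\frac{m^ku_k(A,B)}{B^k}\cdot\frac{\binom{2k}k^h}{(-4)^{hk}}\pmod p$$ and $$\sum_{k=0}^{p^a-1}\frac{v_k(A,B)}{m^k}\cdot\frac{\binom{2k}k^h}{(-4)^{hk}}\equiv\left(\frac{2m(A+\delta)}{p^a}\right)\sum_{k=0}^{p^a-1}\frac{m^kv_k(A,B)}{B^k}\cdot\frac{\binom{2k}k^h}{(-4)^{hk}}\pmod p.$$ If $\left(\frac B{p^a}\right)=-1$, then $$\sum_{k=0}^{p^a-1}\frac{u_k(A,B)}{m^k}\cdot\frac{\binom{2k}k^h}{(-4)^{hk}}\equiv\frac1{\delta}\left(\frac{2m(A+\delta)}{p^a}\right)\sum_{k=0}^{p^a-1}\frac{m^kv_k(A,B)}{B^k}\cdot\frac{\binom{2k}k^h}{(-4)^{hk}}\pmod p$$ and $$\sum_{k=0}^{p^a-1}\frac{v_k(A,B)}{m^k}\cdot\frac{\binom{2k}k^h}{(-4)^{hk}}\equiv-\delta\left(\frac{2m(A+\delta)}{p^a}\right)\sum_{k=0}^{p^a-1}\frac{m^ku_k(A,B)}{B^k}\cdot\frac{\binom{2k}k^h}{(-4)^{hk}}\pmod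 p.$$
   Context: For $A,B\in\mathbb Z$ the Lucas sequences are defined by $u_0=0$, $u_1=1$, $u_{n+1}=Au_n-Bu_{n-1}$ and $v_0=2$, $v_1=A$, $v_{n+1}=Av_n-Bv_{n-1}$ ($n\ge1$); we write $u_n(A,B)$, $v_n(A,B)$. $\left(\frac{\cdot}{p^a}\right)$ denotes the Jacobi symbol. Congruences between rationals with denominators prime to $p$ are understood in the ring of such rationals. *)

(* Defs.v *)
From mathcomp Require Import all_boot all_order all_algebra.

Set Implicit Arguments.
Unset Strict Implicit.
Unset Printing Implicit Defensive.

Import Order.TTheory GRing.Theory Num.Theory.
Local Open Scope ring_scope.

Fixpoint lucasU (A B : int) (n : nat) : int :=
  match n with
  | 0%N => 0
  | n'.+1 => match n' with
             | 0%N => 1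
             | n''.+1 => A * lucasU A B n' - B * lucasU A B n''
             end
  end.

Fixpoint lucasV (A B : int) (n : nat) : int :=
  match n with
  | 0%N => 2
  | n'.+1 => match n' with
             | 0%N => A
             | n''.+1 => A * lucasV A B n' - B * lucasV A B n''
             end
  end.

(* Only meant for p an odd prime. *)
Definition legendre (x : int) (p : nat) : int :=
  if (p%:Z %| x)%Z then 0
  else if [exists y : 'I_p, (y%:Z ^+ 2 == x %[mod p%:Z])%Z] then 1
  else -1.

(* Only meant for n odd and positive. *)
Definition jacobi (x : int) (n : nat) : int :=
  \prod_(q <- primes n) legendre x q ^+ logn q n.

Definition zlocal (p : nat) : pred rat := [pred x | coprime p `|denq x|%N].

(* Congruence modulo p in the ring zlocal p: both sides are required to lie in
   that ring, and the difference to lie in the ideal generated by p. *)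
Definition zlocal_eqmod (p : nat) (x y : rat) : Prop :=
  [/\ x \in zlocal p, y \in zlocal p &
      exists2 z : rat, z \in zlocal p & x - y = p%:R * z].

(* Main.v *)
(* Let F be the field with p elements, q = p^a and n = (q-1)/2. In F,
   C(2k,k)/(-4)^k = C(-1/2,k) coincides with C(n,k) for k < q: for k <= n
   because -1/2 and n are p-adically close, for k > n because both vanish.
   So each sum is a combination of values of P(x) = sum_k C(n,k)^h x^k. This
   polynomial is palindromic, P(x) = x^n P(1/x), and x^n is the Jacobi symbol of
   x by Euler's criterion. With s, t = (A +- delta)/2 the roots of X^2 - A X + B
   in F, the Binet formulas express the left-hand sides by P(s/m), P(t/m) and the
   right-hand sides by P(ms/B) = P(m/t), P(mt/B) = P(m/s). *)

Require Import Defs.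
From mathcomp Require Import all_boot all_order all_algebra.
From mathcomp Require Import all_solvable all_field.
From mathcomp Require Import ring zify.

Set Implicit Arguments.
Unset Strict Implicit.
Unset Printing Implicit Defensive.

Import Order.TTheory GRing.Theory Num.Theory.
Local Open Scope ring_scope.

(** * Binet formulas for the Lucas sequences *)

(** The factor [s - t] stays on the left, so that the formula makes sense in any commutative ring
    without inverting it. *)
Lemma lucasU_closed (R : comPzRingType) (A B : int) (s t : R) :
  s + t = A%:~R -> s * t = B%:~R ->
  forall k, (lucasU A B k)%:~R * (s - t) = s ^+ k - t ^+ k.
Proof.
move=> hA hB k.
suff [] : (lucasU A B k)%:~R * (s - t) = s ^+ k - t ^+ k /\
          (lucasU A B k.+1)%:~R * (s - t) = s ^+ k.+1 - t ^+ k.+1 by [].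
elim: k => [|k [IH1 IH2]]; first by rewrite /= !expr0 !expr1; split; ring.
split=> //.
rewrite -[lucasU A B k.+2]/(A * lucasU A B k.+1 - B * lucasU A B k).
rewrite rmorphB !rmorphM /= mulrBl -!mulrA IH1 IH2 -hA -hB !exprS; ring.
Qed.

Lemma lucasV_closed (R : comPzRingType) (A B : int) (s t : R) :
  s + t = A%:~R -> s * t = B%:~R ->
  forall k, (lucasV A B k)%:~R = s ^+ k + t ^+ k.
Proof.
move=> hA hB k.
suff [] : (lucasV A B k)%:~R = s ^+ k + t ^+ k /\
          (lucasV A B k.+1)%:~R = s ^+ k.+1 + t ^+ k.+1 by [].
elim: k => [|k [IH1 IH2]]; first by rewrite /= !expr0 !expr1 hA; split.
split=> //.
rewrite -[lucasV A B k.+2]/(A * lucasV A B k.+1 - B * lucasV A B k).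
rewrite rmorphB !rmorphM /= IH1 IH2 -hA -hB !exprS; ring.
Qed.

(** * Euler's criterion and palindromic binomial sums *)

(** The nonzero elements are the powers of some [g] of order [2 * n]. If [x = g ^+ i] and
    [x ^+ n = 1], then [2 * n] divides [i * n], so [i] is even. *)
Lemma finField_euler_criterion (F : finFieldType) (n : nat) (x : F) :
  #|F| = (2 * n).+1 -> x != 0 -> x ^+ n = 1 <-> exists y, y ^+ 2 = x.
Proof.
move=> cardF nz_x.
have unitF (y : F) : y != 0 -> y ^+ (2 * n) = 1.
  by move=> nz_y; apply: (mulfI nz_y); rewrite -exprS -cardF expf_card mulr1.
split=> [xn1 | [y yx]]; last first.
  rewrite -yx -exprM unitF //; apply: contraNneq nz_x => y0.
  by rewrite -yx y0 expr0n.
have n_gt0 : (0 < n)%N.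
  rewrite lt0n; apply/eqP => n0; have := finNzRing_gt1 F.
  by rewrite cardF n0.
have /hasP[g _ prim_g] : has (2 * n).-primitive_root [seq y <- enum F | y != 0].
  apply: has_prim_root.
  - by rewrite muln_gt0.
  - apply/allP => y; rewrite mem_filter => /andP[/unitF yn _].
    exact/unity_rootP.
  - by rewrite filter_uniq // enum_uniq.
  - have <- : #|predC1 (0 : F)| = (2 * n)%N by rewrite cardC1 cardF.
    rewrite cardE; apply: uniq_leq_size (enum_uniq _) _ => y.
    by rewrite mem_enum inE mem_filter mem_enum => ->.
have [i xg] := prim_rootP prim_g (unitF _ nz_x).
have : (2 * n %| i * n)%N by rewrite (prim_order_dvd prim_g) exprM -xg xn1.
rewrite dvdn_pmul2r // => /dvdnP[j ij].
by exists (g ^+ j); rewrite xg -exprM ij.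
Qed.

(* Reversing [k] into [n - k] shows that these polynomials are palindromic. *)
Lemma binomial_sum_reciprocal (F : fieldType) (n N h : nat) (x : F) :
  (n < N)%N -> (0 < h)%N -> x != 0 ->
  \sum_(0 <= k < N) x ^+ k * 'C(n, k)%:R ^+ h =
  x ^+ n * \sum_(0 <= k < N) x^-1 ^+ k * 'C(n, k)%:R ^+ h.
Proof.
move=> n_lt h_gt0 x0.
(* Terms with [k > n] vanish because [h > 0]; for [h = 0] they would contain [0 ^+ 0 = 1]. *)
have trunc (y : F) : \sum_(0 <= k < N) y ^+ k * 'C(n, k)%:R ^+ h =
    \sum_(0 <= k < n.+1) y ^+ k * 'C(n, k)%:R ^+ h.
  rewrite (@big_cat_nat _ _ _ n.+1) //= [X in _ + X]big_nat.
  rewrite [X in _ + X]big1 ?addr0 // => k.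
  by case/andP=> k_gt _; rewrite bin_small // expr0n eqn0Ngt h_gt0 mulr0.
rewrite !trunc big_nat_rev /= big_distrr /=.
rewrite big_nat [RHS]big_nat; apply: eq_bigr => k /andP[_].
rewrite ltnS => k_le.
rewrite add0n subSS bin_sub // mulrA; congr (_ * _).
by rewrite exprB // ?unitfE // exprVn.
Qed.

(** * Reduction modulo [p] of p-integral rationals *)

Section PrimeField.

Variable p : nat.
Hypothesis p_prime : prime p.

Let pcharFp : p \in [pchar 'F_p] := pchar_Fp p_prime.

Lemma intr_Fp_eq0 (x : int) : (x%:~R == 0 :> 'F_p) = (p%:Z %| x)%Z.
Proof. by rewrite (dvdz_pcharf pcharFp). Qed.

Lemma intr_Fp_eq (x y : int) : (x%:~R == y%:~R :> 'F_p) = (x == y %[mod p])%Z.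
Proof. by rewrite -subr_eq0 -rmorphB /= intr_Fp_eq0 eqz_mod_dvd. Qed.

(* Reduction of p-integral rationals modulo p, as a relation so that no junk
   value is needed for the other rationals. *)
Definition reduces_to (x : rat) (c : 'F_p) : Prop :=
  exists n d : int,
    [/\ d%:~R != 0 :> 'F_p, x = n%:~R / d%:~R & c = n%:~R / d%:~R].

Lemma intr_rat_neq0 (d : int) : d%:~R != 0 :> 'F_p -> d%:~R != 0 :> rat.
Proof. by apply: contraNneq => /eqP; rewrite intr_eq0 => /eqP ->. Qed.

Lemma reduces_int (n : int) : reduces_to n%:~R n%:~R.
Proof. by exists n, 1; rewrite !divr1 oner_neq0. Qed.

Lemma reduces_nat (n : nat) : reduces_to n%:R n%:R.
Proof. exact: (reduces_int n). Qed.

Lemma reducesN x c : reduces_to x c -> reduces_to (- x) (- c).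
Proof.
by move=> [n [d [d0 -> ->]]]; exists (- n), d; rewrite !rmorphN /= !mulNr.
Qed.

Lemma reducesD x y c e :
  reduces_to x c -> reduces_to y e -> reduces_to (x + y) (c + e).
Proof.
move=> [n [d [d0 -> ->]]] [m [f [f0 -> ->]]].
have [d0Q f0Q] := (intr_rat_neq0 d0, intr_rat_neq0 f0).
exists (n * f + m * d), (d * f); rewrite !(rmorphD, rmorphM) /= mulf_neq0 //.
by split; rewrite ?addf_div.
Qed.

Lemma reducesM x y c e :
  reduces_to x c -> reduces_to y e -> reduces_to (x * y) (c * e).
Proof.
move=> [n [d [d0 -> ->]]] [m [f [f0 -> ->]]].
by exists (n * m), (d * f); rewrite !rmorphM /= mulf_neq0 // !mulf_div.
Qed.

Lemma reducesV x c : c != 0 -> reduces_to x c -> reduces_to x^-1 c^-1.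
Proof.
move=> c0 [n [d [d0 -> cE]]]; exists d, n; rewrite cE !invf_div; split=> //.
by move: c0; rewrite cE mulf_eq0 negb_or => /andP[].
Qed.

Lemma reducesX x c k : reduces_to x c -> reduces_to (x ^+ k) (c ^+ k).
Proof.
move=> xc; elim: k => [|k IHk]; first exact: (reduces_nat 1).
by rewrite !exprS; apply: reducesM.
Qed.

Lemma reduces_sum n (x : nat -> rat) (c : nat -> 'F_p) :
  (forall k, (k < n)%N -> reduces_to (x k) (c k)) ->
  reduces_to (\sum_(0 <= k < n) x k) (\sum_(0 <= k < n) c k).
Proof.
elim: n => [|n IHn] xc; first by rewrite !big_geq //; apply: (reduces_nat 0).
rewrite !big_nat_recr //=; apply: reducesD; last exact: xc.
by apply: IHn => k kn; apply: xc; rewrite ltnW.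
Qed.

(** Residues are well defined, so an identity between rationals yields one in ['F_p]. *)
Lemma reduces_uniq x c e : reduces_to x c -> reduces_to x e -> c = e.
Proof.
move=> [n [d [d0 -> ->]]] [m [f [f0 /eqP + ->]]].
rewrite eqr_div ?intr_rat_neq0 // -!rmorphM eqr_int => /eqP nf.
by apply/eqP; rewrite eqr_div // -!rmorphM nf.
Qed.

Lemma reduces_zlocal x c : reduces_to x c -> x \in zlocal p.
Proof.
move=> [n [d [d0 xE _]]]; rewrite inE prime_coprime //.
apply: contra (d0) => p_dvd; rewrite intr_Fp_eq0.
have d0Q := intr_rat_neq0 d0.
have /eqP : x * d%:~R = n%:~R by rewrite xE divfK.
rewrite -{1}[x]divq_num_den mulrAC.
rewrite (can2_eq (divfK _) (mulfK _)) ?intr_eq0 ?denq_neq0 // -!rmorphM eqr_int.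
move=> /eqP E.
(* [numq x] is coprime to [denq x], so [denq x] divides [d]; a factor [p] of [denq x] would then
   divide [d]. *)
have : (denq x %| numq x * d)%Z by rewrite E dvdz_mull.
rewrite Gauss_dvdzr; last by rewrite coprimezE coprime_sym coprime_num_den.
exact: dvdn_trans.
Qed.

(** Carries equalities in ['F_p] back to congruences: [x - y] has residue 0, so it is a fraction
    whose numerator is a multiple of [p] and whose denominator is prime to [p]. *)
Lemma reduces_eqmod x y c :
  reduces_to x c -> reduces_to y c -> zlocal_eqmod p x y.
Proof.
move=> xc yc; split; [exact: reduces_zlocal xc|exact: reduces_zlocal yc|].
have [n [d [d0 -> nd0]]] := reducesD xc (reducesN yc).
move/esym/eqP: nd0; rewrite subrr mulf_eq0 invr_eq0 (negPf d0) orbF.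
rewrite intr_Fp_eq0 => /dvdzP[t ->].
exists (t%:~R / d%:~R); last by rewrite rmorphM /= mulrCA mulrA.
by apply: (@reduces_zlocal _ (t%:~R / d%:~R)); exists t, d.
Qed.

(** * Legendre and Jacobi symbols as powers in ['F_p] *)

Lemma expFp (x : 'F_p) : x ^+ p = x.
Proof. by have := expf_card x; rewrite card_Fp. Qed.

Hypothesis p_odd : odd p.

Lemma two_Fp_neq0 : 2%:R != 0 :> 'F_p.
Proof.
rewrite -(dvdn_pcharf pcharFp) dvdn_prime2 //.
by apply: contraTneq p_odd => ->.
Qed.

Lemma four_Fp_neq0 : 4%:R != 0 :> 'F_p.
Proof. by rewrite (natrM _ 2 2) mulf_neq0 ?two_Fp_neq0. Qed.

Lemma legendre_Fp (x : int) :
  (legendre x p)%:~R = x%:~R ^+ p./2 :> 'F_p.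
Proof.
have pE : p = (2 * p./2).+1 by rewrite -{1}[p]odd_double_half p_odd -mul2n.
have cardFp : #|'F_p| = (2 * p./2).+1 by rewrite card_Fp.
have half_gt0 : (0 < p./2)%N by rewrite half_gt0 prime_gt1.
rewrite /legendre -intr_Fp_eq0.
have [-> | nz_x] := eqVneq; first by rewrite expr0n eqn0Ngt half_gt0.
have euler := finField_euler_criterion cardFp nz_x.
case: existsP => [[y] | no_sqrt].
  rewrite -intr_Fp_eq => /eqP yx; apply/esym/euler.
  by exists (y%:Z)%:~R; rewrite -rmorphXn.
(* By Fermat the half power is 1 or -1, and by Euler's criterion the value 1 would provide a square
   root. *)
have : (x%:~R ^+ p./2) ^+ 2 == 1 :> 'F_p.
  rewrite -exprM mulnC; apply/eqP/(mulfI nz_x).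
  by rewrite -exprS -pE expFp mulr1.
rewrite sqrf_eq1 => /orP[/eqP/euler[y yx] | /eqP-> //].
case: no_sqrt.
have y_lt : (y < p)%N by rewrite -[ltnRHS]Fp_cast.
exists (Ordinal y_lt); rewrite -intr_Fp_eq rmorphXn /= -yx.
by rewrite -[in eqbRHS](natr_Zp y).
Qed.

Lemma jacobi_prime_power (x : int) (a : nat) :
  (0 < a)%N -> jacobi x (p ^ a) = legendre x p ^+ a.
Proof.
move=> a_gt0; rewrite /jacobi primesX // primes_prime // big_seq1.
by rewrite pfactorK.
Qed.

Lemma jacobi_Fp (x : int) (a : nat) : (0 < a)%N ->
  (jacobi x (p ^ a))%:~R = x%:~R ^+ (p ^ a)./2 :> 'F_p.
Proof.
move=> a_gt0; rewrite jacobi_prime_power // rmorphXn /= legendre_Fp.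
elim: a {a_gt0} => [|a IHa] //.
(* Raising to the power [p] is trivial on ['F_p], so this splitting of the exponent contributes
   exactly one more Legendre factor. *)
have -> : (p ^ a.+1)./2 = ((p ^ a)./2 * p + p./2)%N.
  have := odd_double_half p; have := odd_double_half (p ^ a).
  rewrite oddX p_odd orbT expnS; lia.
by rewrite exprD exprM expFp exprSr IHa.
Qed.

(** * Central binomial coefficients modulo [p] *)

(** As [i < p ^ a], the exponent of [p] in [i] is below [a], so after cancellation a factor [p]
    survives in the numerator. *)
Lemma reduces_prime_power_div (a i : nat) :
  (0 < i < p ^ a)%N -> reduces_to ((p ^ a)%:R / i%:R) 0.
Proof.
case/andP=> i_gt0 i_lt; have [r p_r iE] := pfactor_coprime p_prime i_gt0.
have e_lt : (logn p i < a)%N.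
  rewrite -(ltn_exp2l _ _ (prime_gt1 p_prime)); apply: leq_ltn_trans i_lt.
  by rewrite dvdn_leq // pfactor_dvdnn.
exists (p ^ (a - logn p i))%N%:Z, r%:Z; split.
- by rewrite -[_%:~R]/(r%:R) -(dvdn_pcharf pcharFp) -prime_coprime.
- rewrite {1}iE -{1}(subnK (ltnW e_lt)) expnD !natrM -mulf_div divff ?mulr1 //.
  by rewrite pnatr_eq0 expn_eq0 negb_and -lt0n prime_gt0.
- rewrite -[(p ^ _)%N%:~R]/((p ^ (a - logn p i))%N%:R) natrX pchar_Fp_0 //.
  by rewrite expr0n subn_eq0 leqNgt e_lt mul0r.
Qed.

(* The ratio is prod_(j < k) (1 - p^a / (2j+1)), where every p^a / (2j+1) lies
   in the maximal ideal because 2j+1 < p^a. *)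
Lemma central_binomial_ratio (a n k : nat) :
  (p ^ a = (2 * n).+1)%N -> (k <= n)%N ->
  exists2 r : rat, reduces_to r 1 &
    'C(n, k)%:R * (- 4%:R) ^+ k = 'C(2 * k, k)%:R * r.
Proof.
move=> qE; elim: k => [|k IHk] k_le.
  by exists 1; [apply: (reduces_nat 1) | rewrite !bin0].
have [r r1 IH] := IHk (ltnW k_le).
exists (r * (1 - (p ^ a)%:R / (2 * k).+1%:R)).
  have q_red : reduces_to ((p ^ a)%:R / (2 * k).+1%:R) 0.
    by apply: reduces_prime_power_div; lia.
  have := reducesM r1 (reducesD (reduces_nat 1) (reducesN q_red)).
  by rewrite subr0 mulr1.
have k1 : k.+1%:R != 0 :> rat by rewrite pnatr_eq0.
have k2 : (2 * k).+1%:R != 0 :> rat by rewrite pnatr_eq0.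
(* Dividing this recurrence, times -4, by the next one gives the factor [-2 (n - k) / (2k + 1)],
   which is [1 - p^a / (2k + 1)] because [2n + 1 = p^a]. *)
have binn : 'C(n, k.+1)%:R = (n%:R - k%:R) * 'C(n, k)%:R / k.+1%:R :> rat.
  apply: (mulfI k1); rewrite [RHS]mulrC divfK // -natrB ?(ltnW k_le) //.
  by rewrite -!natrM mul_bin_left.
have binc : 'C(2 * k.+1, k.+1)%:R =
    2%:R * (2 * k).+1%:R * 'C(2 * k, k)%:R / k.+1%:R :> rat.
  apply: (mulfI (mulf_neq0 k1 k1)); rewrite [RHS]mulrC mulrA divfK //.
  rewrite -!natrM; congr _%:R.
  have := mul_bin_diag (2 * k).+2 k; have := mul_bin_down (2 * k).+1 k.
  rewrite /= (_ : 2 * k.+1 = (2 * k).+2)%N; last by lia.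
  have -> : ((2 * k).+1 - k = k.+1)%N by lia.
  nia.
rewrite binn binc exprS.
have -> : (n%:R - k%:R) * 'C(n, k)%:R / k.+1%:R * (- 4%:R * (- 4%:R) ^+ k) =
    - 4%:R * (n%:R - k%:R) / k.+1%:R * ('C(n, k)%:R * (- 4%:R) ^+ k) :> rat.
  by ring.
rewrite IH qE.
move: k1 k2; rewrite -!(@natr1 _ k) -!(@natr1 _ (2 * k)) -!(@natr1 _ (2 * n)).
rewrite !natrM => k1 k2.
by field; rewrite k1 k2.
Qed.

(** Vandermonde with [2k = p^a + (2k - p^a)]: the term of index 0 vanishes since [2k - p^a < k], and
    for [0 < j < p^a] the identity [j C(p^a, j) = p^a C(p^a - 1, j - 1)] forces [p] to divide
    [C(p^a, j)]. *)
Lemma central_binomial_dvd (a k : nat) :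
  (k < p ^ a < 2 * k)%N -> (p %| 'C(2 * k, k))%N.
Proof.
case/andP=> k_lt lt_k; rewrite -(subnKC (ltnW lt_k)) -binomial.Vandermonde.
apply: dvdn_sum => -[[|j] /= j_lt] _.
  by rewrite subn0 (@bin_small (2 * k - _)) ?muln0 ?dvdn0 //; lia.
apply: dvdn_mulr; apply: contraLR j_lt => p_ndvd; rewrite -leqNgt.
have : (p ^ a %| j.+1 * 'C(p ^ a, j.+1))%N by rewrite -mul_bin_diag dvdn_mulr.
rewrite Gauss_dvdl ?coprimeXl ?prime_coprime // => /dvdn_leq; lia.
Qed.

Lemma central_binomial_Fp (a n k : nat) :
  (p ^ a = (2 * n).+1)%N -> (k < p ^ a)%N ->
  'C(2 * k, k)%:R / (- 4%:R) ^+ k = 'C(n, k)%:R :> 'F_p.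
Proof.
move=> qE k_lt.
have four : - 4%:R != 0 :> 'F_p by rewrite oppr_eq0 four_Fp_neq0.
have [k_le | k_gt] := leqP k n.
  have [r r1 E] := central_binomial_ratio qE k_le.
  apply: (canLR (mulfK (expf_neq0 _ four))).
  (* Since [r] has residue 1, both sides are residues of the same rational. *)
  rewrite -[LHS]mulr1; apply: (@reduces_uniq ('C(2 * k, k)%:R * r)).
    by apply: reducesM r1; apply: reduces_nat.
  rewrite -E; apply: reducesM; first exact: reduces_nat.
  by apply/reducesX/reducesN/reduces_nat.
rewrite (@bin_small n) //; apply/eqP; rewrite mulf_eq0 -(dvdn_pcharf pcharFp).
by rewrite (@central_binomial_dvd a) //; lia.
Qed.

(** * The four sums in ['F_p] *)

Lemma expFp_pow (a : nat) (x : 'F_p) : x ^+ (p ^ a) = x.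
Proof. by elim: a => [|a IHa]; rewrite ?expr1 // expnSr exprM IHa expFp. Qed.

Lemma expFp_half (a n : nat) (x : 'F_p) :
  (p ^ a = (2 * n).+1)%N -> x != 0 -> x ^+ n * x ^+ n = 1.
Proof.
move=> qE x0; apply: (mulfI x0).
by rewrite -exprD addnn -mul2n -exprS -qE expFp_pow mulr1.
Qed.

Lemma reduces_central_binomial_sum (a n h : nat) (f : nat -> rat)
    (g : nat -> 'F_p) :
  (p ^ a = (2 * n).+1)%N -> (forall k, reduces_to (f k) (g k)) ->
  reduces_to
    (\sum_(0 <= k < p ^ a)
       f k * ('C(2 * k, k)%:R ^+ h / (- 4%:R) ^+ (h * k)))
    (\sum_(0 <= k < p ^ a) g k * 'C(n, k)%:R ^+ h).
Proof.
move=> qE fg; apply: reduces_sum => k k_lt; apply: reducesM => //.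
rewrite -(central_binomial_Fp qE k_lt) (mulnC h) exprM -expr_div_n.
apply/reducesX/reducesM; first exact: reduces_nat.
apply: reducesV; last exact/reducesX/reducesN/reduces_nat.
by rewrite expf_neq0 // oppr_eq0 four_Fp_neq0.
Qed.

(** [J] and [e] stand for the symbols of [2m(A + delta)] and [B]. With [w = m / (s * t)], the points
    [t * w] and [s * w] are [m / s] and [m / t], the inverses of the arguments on the left-hand
    sides. The [lucasU] sums are scaled by [s - t] to match Binet's formula. *)
Lemma lucas_binomial_sum_Fp (A B : int) (a n h : nat) (s t m J e : 'F_p) :
  (p ^ a = (2 * n).+1)%N -> (0 < h)%N -> m != 0 -> s * t != 0 ->
  s + t = A%:~R -> s * t = B%:~R ->
  J = (m * s) ^+ n -> e = (s * t) ^+ n ->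
  let b k : 'F_p := 'C(n, k)%:R ^+ h in
  let P x := \sum_(0 <= k < p ^ a) x ^+ k * b k in
  let w := m / (s * t) in
  [/\ (\sum_(0 <= k < p ^ a) (lucasU A B k)%:~R / m ^+ k * b k) * (s - t)
        = J * (P (t * w) - e * P (s * w)),
      \sum_(0 <= k < p ^ a) (lucasV A B k)%:~R / m ^+ k * b k
        = J * (P (t * w) + e * P (s * w)),
      (\sum_(0 <= k < p ^ a) m ^+ k * (lucasU A B k)%:~R / (s * t) ^+ k * b k)
        * (s - t) = P (s * w) - P (t * w) &
      \sum_(0 <= k < p ^ a) m ^+ k * (lucasV A B k)%:~R / (s * t) ^+ k * b k
        = P (s * w) + P (t * w)].
Proof.
move=> qE h_gt0 m0 st0 hA hB JE eE b P w.
have [s0 t0] : s != 0 /\ t != 0 by apply/andP; rewrite -negb_or -mulf_eq0.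
have P_inv x : x != 0 -> P x = x ^+ n * P x^-1.
  apply: binomial_sum_reciprocal => //.
  by rewrite qE ltnS mul2n -addnn leq_addr.
(* Here [(s / m) ^+ n = (m * s) ^+ n], because [m ^+ n] is its own inverse. *)
have Ps : P (s / m) = J * P (t * w).
  rewrite P_inv ?mulf_neq0 ?invr_eq0 // invf_div JE /w.
  have -> : t * (m / (s * t)) = m / s by field; rewrite s0 t0.
  congr (_ * _); rewrite !exprMn exprVn -[LHS]mulr1 -(expFp_half qE m0).
  by field; rewrite expf_neq0.
(* The extra [e] appears because [(m * t) ^+ n = (m * s) ^+ n * (s * t) ^+ n], as [s ^+ n] squares
   to 1. *)
have Pt : P (t / m) = J * e * P (s * w).
  rewrite P_inv ?mulf_neq0 ?invr_eq0 // invf_div JE eE /w.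
  have -> : s * (m / (s * t)) = m / t by field; rewrite s0 t0.
  congr (_ * _); rewrite !exprMn exprVn.
  rewrite -[LHS]mulr1 -(expFp_half qE m0) -[LHS]mulr1 -(expFp_half qE s0).
  by field; rewrite expf_neq0.
have U := lucasU_closed hA hB; have V := lucasV_closed hA hB.
rewrite (mulrBr J) (mulrDr J) (mulrA J e) -Ps -Pt /P; split.
- rewrite big_distrl -sumrB /=; apply: eq_bigr => k _.
  by rewrite mulrAC (mulrAC _ _ (s - t)) U !exprMn exprVn; ring.
- rewrite -big_split /=; apply: eq_bigr => k _.
  by rewrite V !exprMn exprVn; ring.
- rewrite big_distrl -sumrB /=; apply: eq_bigr => k _.
  rewrite /w mulrAC (mulrAC _ _ (s - t)) -mulrA -(mulrA (m ^+ k)) U.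
  by rewrite !exprMn exprVn ?exprMn; ring.
- rewrite -big_split /=; apply: eq_bigr => k _.
  by rewrite V /w !exprMn exprVn ?exprMn; ring.
Qed.

End PrimeField.

(** * Transfer of the congruences to identities in ['F_p] *)

Theorem theorem2p1 (A B Delta : int) (hDelta : Delta = A ^+ 2 - 4 * B)
    (p : nat) (hp : prime p) (hp_odd : odd p)
    (hleg : legendre Delta p = 1)
    (delta : int) (hdelta : (delta ^+ 2 = Delta %[mod p%:Z])%Z)
    (hDelta0 : (Delta <> 0 %[mod p%:Z])%Z)
    (a h : nat) (ha : (0 < a)%N) (hh : (0 < h)%N)
    (m : int) (hm : (m <> 0 %[mod p%:Z])%Z) :
  (jacobi B (p ^ a) = 1 ->
     zlocal_eqmod p
       (\sum_(0 <= k < p ^ a) (lucasU A B k)%:Q / m%:Q ^+ k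
          * ('C(2 * k, k)%:R ^+ h / (- 4%:R) ^+ (h * k)))
       (- (jacobi (2 * m * (A + delta)) (p ^ a))%:Q
        * \sum_(0 <= k < p ^ a) m%:Q ^+ k * (lucasU A B k)%:Q / B%:Q ^+ k
            * ('C(2 * k, k)%:R ^+ h / (- 4%:R) ^+ (h * k)))
     /\
     zlocal_eqmod p
       (\sum_(0 <= k < p ^ a) (lucasV A B k)%:Q / m%:Q ^+ k
          * ('C(2 * k, k)%:R ^+ h / (- 4%:R) ^+ (h * k)))
       ((jacobi (2 * m * (A + delta)) (p ^ a))%:Q
        * \sum_(0 <= k < p ^ a) m%:Q ^+ k * (lucasV A B k)%:Q / B%:Q ^+ k
            * ('C(2 * k, k)%:R ^+ h / (- 4%:R) ^+ (h * k))))
  /\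
  (jacobi B (p ^ a) = -1 ->
     zlocal_eqmod p
       (\sum_(0 <= k < p ^ a) (lucasU A B k)%:Q / m%:Q ^+ k
          * ('C(2 * k, k)%:R ^+ h / (- 4%:R) ^+ (h * k)))
       (1 / delta%:Q * (jacobi (2 * m * (A + delta)) (p ^ a))%:Q
        * \sum_(0 <= k < p ^ a) m%:Q ^+ k * (lucasV A B k)%:Q / B%:Q ^+ k
            * ('C(2 * k, k)%:R ^+ h / (- 4%:R) ^+ (h * k)))
     /\
     zlocal_eqmod p
       (\sum_(0 <= k < p ^ a) (lucasV A B k)%:Q / m%:Q ^+ k
          * ('C(2 * k, k)%:R ^+ h / (- 4%:R) ^+ (h * k)))
       (- delta%:Q * (jacobi (2 * m * (A + delta)) (p ^ a))%:Q
        * \sum_(0 <= k < p ^ a) m%:Q ^+ k * (lucasU A B k)%:Q / B%:Q ^+ k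
            * ('C(2 * k, k)%:R ^+ h / (- 4%:R) ^+ (h * k)))).
Proof.
have qE : (p ^ a = (2 * (p ^ a)./2).+1)%N.
  by rewrite mul2n -[LHS]odd_double_half oddX hp_odd orbT.
set n := (p ^ a)./2 in qE.
have n_gt0 : (0 < n)%N by rewrite half_gt0 -(exp1n a) ltn_exp2r // prime_gt1.
have two0 := two_Fp_neq0 hp hp_odd.
have four0 := four_Fp_neq0 hp hp_odd.
have m0 : m%:~R != 0 :> 'F_p.
  by rewrite -[0]/(0%:~R) intr_Fp_eq //; apply/eqP.
pose d : 'F_p := delta%:~R.
have dD : d ^+ 2 = Delta%:~R.
  by rewrite -rmorphXn /=; apply/eqP; rewrite intr_Fp_eq //; apply/eqP.
have d2 : d ^+ 2 = A%:~R ^+ 2 - 4%:R * B%:~R.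
  by rewrite dD hDelta rmorphB rmorphXn rmorphM.
have d0 : d != 0.
  apply/eqP => d0; apply: hDelta0; apply/eqP.
  by rewrite -intr_Fp_eq // -dD d0 expr0n.
pose s := (A%:~R + d) / 2%:R; pose t := (A%:~R - d) / 2%:R.
have hA : s + t = A%:~R by rewrite /s /t; field.
have hB : s * t = B%:~R.
  have -> : s * t = (A%:~R ^+ 2 - d ^+ 2) / (2%:R * 2%:R).
    by rewrite /s /t; field; rewrite four0 two0.
  by rewrite d2; field; rewrite four0.
have hst : s - t = d by rewrite /s /t; field.
pose J : 'F_p := (jacobi (2 * m * (A + delta)) (p ^ a))%:~R.
have JE : J = (m%:~R * s) ^+ n.
  rewrite /J jacobi_Fp // !(rmorphM, rmorphD) /= -/d.
  (* The symbol's argument is [4 m s], and [4 = 2 * 2] contributes [2 ^+ n * 2 ^+ n = 1]. *)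
  have -> : 2%:~R * m%:~R * (A%:~R + d) = 2%:R * 2%:R * (m%:~R * s).
    by rewrite /s; field.
  by rewrite exprMn exprMn (expFp_half hp qE) // mul1r.
have eE : (jacobi B (p ^ a))%:~R = (s * t) ^+ n by rewrite hB jacobi_Fp.
have J_red : reduces_to (jacobi (2 * m * (A + delta)) (p ^ a))%:~R J.
  exact: reduces_int.
have d_red : reduces_to delta%:~R d by apply: reduces_int.
pose b k : 'F_p := 'C(n, k)%:R ^+ h.
pose S1 (W : nat -> int) : 'F_p :=
  \sum_(0 <= k < p ^ a) (W k)%:~R / m%:~R ^+ k * b k.
pose S2 (W : nat -> int) : 'F_p :=
  \sum_(0 <= k < p ^ a) m%:~R ^+ k * (W k)%:~R / B%:~R ^+ k * b k.
have S1_red W : reduces_to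
    (\sum_(0 <= k < p ^ a) (W k)%:Q / m%:Q ^+ k
       * ('C(2 * k, k)%:R ^+ h / (- 4%:R) ^+ (h * k))) (S1 W).
  apply: (reduces_central_binomial_sum hp hp_odd _ qE) => k.
  apply: reducesM; first exact: reduces_int.
  by apply: reducesV; [rewrite expf_neq0 | apply/reducesX/reduces_int].
have S2_red W : B%:~R != 0 :> 'F_p -> reduces_to
    (\sum_(0 <= k < p ^ a) m%:Q ^+ k * (W k)%:Q / B%:Q ^+ k
       * ('C(2 * k, k)%:R ^+ h / (- 4%:R) ^+ (h * k))) (S2 W).
  move=> B0; apply: (reduces_central_binomial_sum hp hp_odd _ qE) => k.
  apply: reducesM.
    by apply: reducesM; [apply/reducesX/reduces_int | apply: reduces_int].
  by apply: reducesV; [rewrite expf_neq0 | apply/reducesX/reduces_int].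
(* A nonzero symbol makes [B] invertible modulo [p], as the denominators [B ^+ k] require. *)
have B_neq0 : (jacobi B (p ^ a))%:~R != 0 :> 'F_p -> B%:~R != 0 :> 'F_p.
  by apply: contraNneq => B0; rewrite eE hB B0 expr0n eqn0Ngt n_gt0.
have sums (B0 : B%:~R != 0 :> 'F_p) :=
  lucas_binomial_sum_Fp hp qE hh m0 (etrans (congr1 (fun x => x != 0) hB) B0)
    hA hB JE eE.
rewrite hst hB /= -/b in sums.
split=> jB.
  (* With [e = 1], differences of values of [P] go to differences and sums to sums, so each Lucas
     sequence is paired with itself. *)
  have B0 : B%:~R != 0 :> 'F_p by apply: B_neq0; rewrite jB oner_neq0.
  have [] := sums B0; rewrite jB mul1r -/(S1 _) -/(S1 _) -/(S2 _) -/(S2 _).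
  move=> U1 V1 U2 V2; split; apply: (reduces_eqmod hp (S1_red _)).
    have -> : S1 (lucasU A B) = - J * S2 (lucasU A B).
      by apply: (mulIf d0); rewrite U1 -(mulrA (- J)) U2; ring.
    by apply: reducesM (S2_red _ B0); apply: reducesN.
  have -> : S1 (lucasV A B) = J * S2 (lucasV A B) by rewrite V1 V2; ring.
  exact: reducesM (S2_red _ B0).
(* With [e = -1], differences and sums are exchanged: [lucasU] is paired with [lucasV], and the
   Binet factor [d] no longer cancels. *)
have B0 : B%:~R != 0 :> 'F_p by apply: B_neq0; rewrite jB oppr_eq0 oner_neq0.
have [] := sums B0; rewrite jB mulN1r -/(S1 _) -/(S1 _) -/(S2 _) -/(S2 _).
move=> U1 V1 U2 V2; split; apply: (reduces_eqmod hp (S1_red _)).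
  have -> : S1 (lucasU A B) = 1 / d * J * S2 (lucasV A B).
    by apply: (mulIf d0); rewrite U1 V2; field.
  rewrite !div1r; apply: reducesM (S2_red _ B0); apply: reducesM J_red.
  exact: reducesV.
have -> : S1 (lucasV A B) = - d * J * S2 (lucasU A B).
  rewrite V1; transitivity (- J * (S2 (lucasU A B) * d)); last by ring.
  by rewrite U2; ring.
by apply: reducesM (S2_red _ B0); apply: reducesM J_red; apply: reducesN.
Qed.
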